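(* With $AC_{\mathcal H}(d,2)=\sup_{l\ge 3}AC_l(d,2)$ as defined in the context, $$AC_{\mathcal H}(d,2)\le \tfrac{3}{8}d^2+O(d).$$
   Context: For a group $H$ and an inverse-closed subset $X\subseteq H$ not containing the identity, $C(H,X)$ denotes the undirected Cayley graph with vertex set $H$ in which $h$ is adjacent to $hx$ for each $x\in X$; its degree is $d=|X|$ and its order is $|H|$. An Abelian Cayley graph is a Cayley graph of an Abelian group. Let $F=GF(p)$ be the Galois field of order $p$, where $p$ is a prime power, with multiplicative group $F^*$ (identity $1$) and additive group $F^+$ (identity $0$). For even $n\in\mathbb{N}$ consider the Abelian group $F^*\times F^+\times\mathbb{Z}_n$ with componentwise operation ($n$ is not required to be coprime to $p$ or $p-1$). For $x\in F^*$, $y\in F^+$, $u,v,w\in\mathbb{Z}_n$ let $a_u(x)=(x,x,u)$, $b_v(x)=(x,0,v)$, $c_w(y)=(1,y,w)$, with inverses $a_u^{-1}(x)=(x^{-1},-x,-u)$, $b_v^{-1}(x)=(x^{-1},0,-v)$, $c_w^{-1}(y)=(1,-y,-w)$. Let $A_u=\{a_u(x),a_u^{-1}(x):x\in F^*\}$, $B_v=\{b_v(x),b_v^{-1}(x):x\in F^*\}$, $C_w^+=\{c_w(y),c_w^{-1}(y):y\in F^+\}$. For any $l\ge 3$ consider different even values of $n$ and, for each $n$, the corresponding family of Abelian groups $H=F^*\times F^+\times\mathbb{Z}_n$ for any prime power $p$. Consider inverse-closed generating sets $X$ of $H$ comprised of all possible combinations of the sets $A_u$, $B_v$, $C_w^+$,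 always including $B_{n/2}$, and with $C_0^+$ included in $X$ if $l$ is even and not included if $l$ is odd, along with a fixed number of other elements of $H$, such that $|X|=lp+\delta$ for some fixed $\delta$, with the condition that the Cayley graph $C(H,X)$ has diameter 2. For any $l$ define $n_l$ to be the largest value of $n$ for which such a Cayley graph $C(H,X)$ exists for all admissible $p$ (that is, all prime powers $p$), and define $H_l=F^*\times F^+\times\mathbb{Z}_{n_l}$. The order of $C(H_l,X)$ is $(n_l/l^2)d^2+O(d)$, and this order is denoted $AC_l(d,2)$. Finally $\mathcal H=\{H_l:l\ge 3\}$ and $AC_{\mathcal H}(d,2)=\sup_{l\ge 3}AC_l(d,2)$. *)

(* Defs.v *)
(* MathComp world, with MathComp-Analysis for real suprema and Landau's O. *)
From HB Require Import structures.
From mathcomp Require Import all_boot all_order all_fingroup all_algebra.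
From mathcomp Require Import all_classical all_reals all_analysis.
Set Implicit Arguments.
Unset Strict Implicit.
Unset Printing Implicit Defensive.

Import Order.TTheory GRing.Theory Num.Theory.

Local Open Scope ring_scope.

Definition cayley (gT : finGroupType) (X : {set gT}) : rel gT :=
  fun h k => (h^-1 * k)%g \in X.

Definition inverse_closed (gT : finGroupType) (X : {set gT}) : Prop :=
  forall x, x \in X -> (x^-1)%g \in X.

Definition distance (T : finType) (e : rel T) (x y : T) (m : nat) : Prop :=
  (exists s : seq T, [/\ path e x s, last x s = y & size s = m]) /\
  (forall s : seq T, path e x s -> last x s = y -> (m <= size s)%N).

Definition diameter (T : finType) (e : rel T) (D : nat) : Prop :=
  (forall x y, exists2 m, distance e x y m & (m <= D)%N) /\
  (exists x y, distance e x y D).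

(* The group F^* x F^+ x Z_n.  A finite field carries two group laws: the group
   structure of the type F is the additive one, that of {unit F} the
   multiplicative one.  Only used for 1 < n, where 'Z_n is Z/nZ. *)
Definition Hgrp (F : finFieldType) (n : nat) : finGroupType :=
  ({unit F} * F * 'Z_n)%type.

Section Blocks.
Variables (F : finFieldType) (n : nat).
Implicit Types (x : {unit F}) (y : F) (u v w : 'Z_n).

Definition elt_a u x : Hgrp F n := (x, val x, u).
Definition elt_b v x : Hgrp F n := (x, 0, v).
Definition elt_c w y : Hgrp F n := (1%g, y, w).

Definition block_A u : {set Hgrp F n} :=
  [set elt_a u x | x in [set: {unit F}]] :|:
  [set (elt_a u x)^-1%g | x in [set: {unit F}]].
Definition block_B v : {set Hgrp F n} :=
  [set elt_b v x | x in [set: {unit F}]] :|: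
  [set (elt_b v x)^-1%g | x in [set: {unit F}]].
Definition block_C w : {set Hgrp F n} :=
  [set elt_c w y | y in [set: F]] :|:
  [set (elt_c w y)^-1%g | y in [set: F]].

Definition blocks (U V W : {set 'Z_n}) : {set Hgrp F n} :=
  (\bigcup_(u in U) block_A u) :|: (\bigcup_(v in V) block_B v)
  :|: (\bigcup_(w in W) block_C w).

(* The blocks A_u (u in U), B_v (v in V), C_w (w in W), together with e other
   elements.  The identity belongs to C_0 and to B_0, and is removed because a
   connection set must not contain it. *)
Definition conn_set (l : nat) (delta : int) (e : nat) (X : {set Hgrp F n})
    : Prop :=
  exists (U V W : {set 'Z_n}) (E : {set Hgrp F n}),
    [/\ n./2%:R \in V /\ (0 \in W) = ~~ odd l,
        [/\ #|E| = e, 1%g \notin E & [disjoint E & blocks U V W]],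
        X = (blocks U V W :\ 1%g) :|: E,
        inverse_closed X /\ <<X>>%g = [set: Hgrp F n]
      & #|X|%:Z = l%:Z * #|F|%:Z + delta /\ diameter (cayley X) 2].

End Blocks.

(* Quantifying over all finite fields F is quantifying over all prime powers
   p = #|F|; delta and e do not depend on p. *)
Definition realizable (l n : nat) (delta : int) (e : nat) : Prop :=
  forall F : finFieldType, exists X : {set Hgrp F n}, conn_set l delta e X.

Definition admissible (l n : nat) : Prop :=
  [/\ ~~ odd n, (1 < n)%N & exists delta e, realizable l n delta e].

Definition is_n (l n : nat) : Prop :=
  admissible l n /\ forall m, admissible l m -> (m <= n)%N.

Section Order.
Variable R : realType.
Local Open Scope classical_set_scope.

(* For given l, delta and d there is at most one order n_l * p * (p - 1), as
   d = l * p + delta determines p.  The value is -oo if no graph of the family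
   has degree d. *)
Definition AC (delta : int) (l d : nat) : \bar R :=
  ereal_sup [set x | exists n e (F : finFieldType) (X : {set Hgrp F n}),
    [/\ is_n l n, realizable l n delta e, conn_set l delta e X, #|X| = d
      & x = (#|Hgrp F n|%:R)%:E]].

Definition ACsup (delta : int) (d : nat) : \bar R :=
  ereal_sup [set AC delta l d | l in [set l | (3 <= l)%N]].

End Order.

(* Main.v *)
(* A realizable n satisfies 8 n <= 3 l^2, which is seen on the fields F = GF(q) with
   q a large power of 2.  Let a = |U|, and let b, c be the numbers of elements of
   V u -V and W u -W.  Counting X gives 2a + b + c <= l.  Let S be the set of
   the z in Z_n of the form u - u', +-u + v, +-u + w or v + w, with u, u' in U,
   v in V u -V and w in W u -W.  If z is not in S, then, up to O(q) exceptions,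
   an element (m, s, z) of H is a product of two elements of X only as
   a_u(x) a_u'(y) or a_u(x)^-1 a_u'(y)^-1, that is, if m or m^-1 is s^2 times a
   value of y^2 + y.  These values form an additive subgroup of index 2, so about
   a quarter of the q (q - 1) elements over z are missed.  Hence S = Z_n and
   n <= (a^2 - a + 1) + 2a(b + c) + bc <= 3/8 (2a + b + c)^2 if a > 0 (for a = 0
   the first term vanishes).  The order is then at most
   3/8 (l q)^2 = 3/8 (d - delta)^2, for any field of q elements. *)
Require Import Defs.
From mathcomp Require Import all_boot all_order all_fingroup all_algebra all_field.
From mathcomp Require Import all_classical all_reals all_analysis.
From mathcomp Require Import ring lra zify.
Import Order.TTheory GRing.Theory Num.Theory.
Import numFieldNormedType.Exports.
Local Open Scope ring_scope.

Set Implicit Arguments.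
Unset Strict Implicit.
Unset Printing Implicit Defensive.

(** * The values of z^2 + z in a finite field of characteristic 2 *)

Section ArtinSchreier.
Variables (F : finFieldType) (charF : 2%N \in [pchar F]).

Definition artin_schreier (z : F) : F := z ^+ 2 + z.

Lemma artin_schreierD : {morph artin_schreier : x y / x + y}.
Proof.
move=> x y; rewrite /artin_schreier -!(pFrobenius_autE charF).
by rewrite rmorphD /= addrACA.
Qed.

Lemma sqr_inj_pchar2 : injective (fun x : F => x ^+ 2).
Proof. by move=> x y; rewrite -!(pFrobenius_autE charF); apply: fmorph_inj. Qed.

Definition artin_schreier_morphism : {morphism [set: F] >-> F} :=
  @Morphism _ _ [set: F] artin_schreier (fun x y _ _ => artin_schreierD x y).

Definition AS : {group F} := (artin_schreier_morphism @* [set: F])%G.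

Lemma ASP (w : F) : reflect (exists z, w = z ^+ 2 + z) (w \in AS).
Proof.
apply: (iffP idP) => [/morphimP[z _ _ ->]|[z ->]]; first by exists z.
by apply: (mem_morphim artin_schreier_morphism); rewrite inE.
Qed.

Lemma card_AS : (#|AS| * 2)%N = #|F|.
Proof.
have kerE : ('ker artin_schreier_morphism)%g = [set 0; 1] :> {set F}.
  apply/setP => z; rewrite !inE /= /artin_schreier.
  have -> : z ^+ 2 + z = z * (z + 1) by ring.
  by rewrite mulf_eq0 addr_eq0 oppr_pchar2.
have card_ker : #|('ker artin_schreier_morphism)%g| = 2%N.
  by rewrite kerE cards2 eq_sym oner_neq0.
rewrite -card_ker card_morphim finset.setIT -cardsT mulnC.
by apply: Lagrange; rewrite finset.subsetT.
Qed.

(** In characteristic 2, w = w^2 + (w^2 + w), and the second summand is itself a value of the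
    map. *)
Lemma AS_sqr (w : F) : w ^+ 2 \in AS -> w \in AS.
Proof.
move=> /ASP[z wz]; apply/ASP; exists (z + w).
have w2 : w + w = 0 by rewrite addrr_pchar2.
have -> : (z + w) ^+ 2 + (z + w) = (z ^+ 2 + z) + w ^+ 2 + z * (w + w) + w by ring.
by rewrite -wz w2 addrr_pchar2 // mulr0 !add0r.
Qed.

Lemma AS_scale_group_set (r : F) : group_set [set t | t * r \in AS].
Proof.
apply/group_setP; split=> [|x y]; rewrite !inE; first by rewrite mul0r group1.
by rewrite mulrDl; apply: groupM.
Qed.

Definition AS_scale (r : F) : {group F} := group (AS_scale_group_set r).

Lemma card_AS_scale (r : F) : r != 0 -> #|AS_scale r| = #|AS|.
Proof.
move=> r0.
suff -> : AS = [set t * r | t in AS_scale r] :> {set F}.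
  by rewrite card_imset //; apply: mulIf.
apply/setP => w; apply/idP/imsetP => [wL|[t]]; last by rewrite inE => ? ->.
by exists (w / r); rewrite ?inE ?divfK.
Qed.

(* The union of two subgroups [K], [L] of index 2 misses [#|K :&: L|] points. *)
Lemma card_AS_avoid (r : F) : r != 0 ->
  (#|F| <= 4 * #|[set t | (t * r \notin AS) && (t / r \notin AS)]%R|)%N.
Proof.
move=> r0; have ri0 : r^-1 != 0 by rewrite invr_eq0.
set N := [set t | _]; pose K := AS_scale r; pose L := AS_scale r^-1.
have NE : N = ~: (K :|: L) by apply/setP => t; rewrite !inE negb_or.
(* As |K| |L| = |KL| |K :&: L|, with |K| = |L| = q/2 and |KL| <= q, the intersection has at least
   q/4 elements. *)
have cKL := mul_cardG K L.
have cU := cardsUI K L; have cC := cardsC (K :|: L).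
have cK := card_AS_scale r0; have cL := card_AS_scale ri0.
have cA := card_AS.
have mulF : (#|(K * L)%g| <= #|F|)%N by apply: max_card.
rewrite NE.
rewrite -/K in cK; rewrite -/L in cL; rewrite cK cL in cKL cU.
move: cKL cU cC cA mulF; move: #|_| #|_| #|_| #|_| #|_| #|_| => s m f i u c.
move=> *; nia.
Qed.

(** A pair (r, t) encodes the elements (r^2, t^-1, z) of the group, for any z. As 0 lies in [AS], t
    is nonzero. *)
Definition avoiding_pairs : {set {unit F} * F} :=
  [set p : {unit F} * F | [&& p.1 != 1%g, p.2 * val p.1 \notin AS & p.2 / val p.1 \notin AS]].

Lemma unit_neq0 (x : {unit F}) : val x != 0.
Proof. by rewrite -unitfE; apply: (valP x). Qed.

Lemma card_avoiding_pairs : ((#|F| - 2) * #|F| <= 4 * #|avoiding_pairs|)%N.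
Proof.
pose N (r : {unit F}) := [set t | (t * val r \notin AS) && (t / val r \notin AS)].
have -> : #|avoiding_pairs| = (\sum_(r : {unit F} | r != 1%g) #|N r|)%N.
  rewrite -sum1_card (eq_bigr (fun r => \sum_(t in N r) 1)%N); last first.
    by move=> r _; rewrite sum1_card.
  by rewrite pair_big_dep; apply: eq_bigl => p; rewrite !inE.
rewrite big_distrr /= -(_ : #|[pred r : {unit F} | r != 1%g]| = (#|F| - 2)%N).
  rewrite -sum_nat_const; apply: leq_sum => r _.
  exact: card_AS_avoid (unit_neq0 r).
have := cardC1 (1%g : {unit F}); rewrite -cardsT card_finField_unit => E.
by rewrite subn2 -E; apply: eq_card => r; rewrite !inE.
Qed.
End ArtinSchreier.

(** * Counting the sums of pairs of indices *)

Section PairSums.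
Variable Z : finZmodType.
Implicit Types U V W : {set Z}.

Definition symmetrized U : {set Z} := U :|: [set - u | u in U].

(** This is the set S of the proof idea. The sums u + u', v + v' and w + w' are left out: the
    corresponding products satisfy the Artin-Schreier condition, have field component 0, or have
    unit component 1. *)
Definition pair_sums U V W : {set Z} :=
  [set u1 - u2 | u1 in U, u2 in U]
  :|: [set x + y | x in symmetrized U, y in symmetrized V :|: symmetrized W]
  :|: [set v + w | v in symmetrized V, w in symmetrized W].

Lemma mem_symmetrized U x : x \in U -> x \in symmetrized U.
Proof. by rewrite inE => ->. Qed.

Lemma mem_symmetrizedN U x : x \in U -> - x \in symmetrized U.
Proof. by move=> xU; rewrite inE imset_f ?orbT. Qed.

Lemma card_symmetrized U : (#|symmetrized U| <= 2 * #|U|)%N.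
Proof.
rewrite /symmetrized cardsU; apply: leq_trans (leq_subr _ _) _.
by rewrite mul2n -addnn leq_add2l leq_imset_card.
Qed.

Lemma card_imset2_leq (aT bT rT : finType) (f : aT -> bT -> rT)
    (A : {set aT}) (B : {set bT}) :
  (#|[set f x y | x in A, y in B]| <= #|A| * #|B|)%N.
Proof. by rewrite curry_imset2X -cardsX leq_imset_card. Qed.

(** The |U| diagonal pairs all give the difference 0, which leaves |U|^2 - |U| other pairs. *)
Lemma card_differences U : (0 < #|U|)%N ->
  (#|[set (u1 - u2)%R | u1 in U, u2 in U]| + #|U| <= #|U| ^ 2 + 1)%N.
Proof.
move=> U0.
pose D := [set p in finset.setX U U | p.1 == p.2].
pose D' := finset.setX U U :\: D.
have cD : #|D| = #|U|.
  have -> : D = [set (u, u) | u in U].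
    apply/setP => -[x y]; rewrite !inE /=; apply/idP/imsetP.
      by case/andP=> /andP[xU _] /eqP <-; exists x.
    by case=> u uU [-> ->]; rewrite uU eqxx.
  by rewrite card_imset // => x y [].
have cD' : #|D'| = (#|U| ^ 2 - #|U|)%N.
  rewrite cardsD cardsX (finset.setIidPr _) ?cD //.
  by apply/fintype.subsetP => p; rewrite !inE => /andP[].
have sub : [set u1 - u2 | u1 in U, u2 in U] \subset
           0 |: [set p.1 - p.2 | p in D'].
  apply/fintype.subsetP => _ /imset2P[x y xU yU ->]; rewrite !inE.
  have [->|xy] := eqVneq x y; first by rewrite subrr eqxx.
  apply/orP; right; apply/imsetP; exists (x, y) => //.
  by rewrite !inE /= xU yU xy.
apply: leq_trans (leq_add (subset_leq_card sub) (leqnn _)) _.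
rewrite cardsU1.
have : (#|[set (p.1 - p.2)%R | p in D']| <= #|D'|)%N by exact: leq_imset_card.
have : (#|U| <= #|U| ^ 2)%N by rewrite -{1}(expn1 #|U|) leq_pexp2l.
rewrite cD'; have := leq_b1 (0 \notin [set p.1 - p.2 | p in D']).
lia.
Qed.

Lemma card_pair_sums U V W (a := #|U|) (b := #|symmetrized V|)
    (c := #|symmetrized W|) :
  (8 * #|pair_sums U V W| <= 3 * (2 * a + b + c) ^ 2)%N.
Proof.
have cUU : (#|[set (u1 - u2)%R | u1 in U, u2 in U]| <= a ^ 2 - a + (0 < a))%N.
  have [a0|a0] := posnP a; last by have := card_differences a0; rewrite -/a; lia.
  have -> : [set u1 - u2 | u1 in U, u2 in U] = finset.set0; last by rewrite cards0.
  apply/setP => z; rewrite !inE; apply/negP => /imset2P[u1 ? u1U].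
  by rewrite (cards0_eq a0) inE in u1U.
have cUVW : (#|[set (x + y)%R | x in symmetrized U, y in symmetrized V :|: symmetrized W]|
    <= 2 * a * (b + c))%N.
  apply: leq_trans (card_imset2_leq _ _ _) _.
  by apply: leq_mul; rewrite ?card_symmetrized // cardsU leq_subr.
have cVW : (#|[set (v + w)%R | v in symmetrized V, w in symmetrized W]| <= b * c)%N.
  exact: card_imset2_leq.
have cU3 : (#|pair_sums U V W| <= a ^ 2 - a + (0 < a) + 2 * a * (b + c) + b * c)%N.
  rewrite /pair_sums cardsU; apply: leq_trans (leq_subr _ _) _.
  apply: leq_add cVW; rewrite cardsU; apply: leq_trans (leq_subr _ _) _.
  exact: leq_add.
(* Put t = b + c. For a > 0, bc <= t^2 / 4 bounds eight times the count by 8a^2 + 16at + 2t^2, which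
   is 3(2a + t)^2 - (2a - t)^2. *)
have [bc _] := nat_AGM2 b c; have [at_ _] := nat_AGM2 (2 * a) (b + c).
move: cU3 bc at_ => {cUU cUVW cVW}; move: a b c #|_| => a b c m.
by have [-> /=|a0] := posnP a; nia.
Qed.
End PairSums.

(** * Diameter 2 and the products of two block elements *)

Lemma cayley_diameter2 (gT : finGroupType) (X : {set gT}) (h : gT) :
  diameter (cayley X) 2 ->
  [\/ h = 1%g, h \in X | exists x y, [/\ x \in X, y \in X & h = (x * y)%g]].
Proof.
case=> /(_ 1%g h)[m [[s [+ + +]] _] m2] _.
case: s => [|x [|y [|z s]]] /=; rewrite /cayley ?invg1 ?mul1g ?andbT.
- by move=> _ ->; constructor 1.
- by move=> ? <-; constructor 2.
- case/andP=> xX yX <- _; constructor 3; exists x, (x^-1 * y)%g.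
  by rewrite mulKVg.
- by move=> _ _ sm; rewrite -sm in m2.
Qed.

Section Covering.
Variables (F : finFieldType) (charF : 2%N \in [pchar F]) (n : nat).
Variables (U V W : {set 'Z_n}).

(* In characteristic 2 the inverse of [a_u(x)] is [(x^-1, x, -u)]. *)
Lemma mem_blocks (g : Hgrp F n) : (g \in blocks F U V W) =
  [|| (g.2 \in U) && (g.1.2 == val g.1.1),
      (- g.2 \in U) && (g.1.2 == (val g.1.1)^-1),
      (g.2 \in symmetrized V) && (g.1.2 == 0)
    | (g.2 \in symmetrized W) && (g.1.1 == 1%g)].
Proof.
case: g => -[x y] z /=; rewrite !inE -orbA.
have eqA : ((x, y, z) \in \bigcup_(u in U) block_A F u) =
    (z \in U) && (y == val x) || (- z \in U) && (y == (val x)^-1).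
  apply/bigcupP/orP => [[u uU]|].
    rewrite inE => /orP[] /imsetP[x' _ [-> -> ->]]; [left|right].
      by rewrite uU eqxx.
    by rewrite opprK uU /=; apply/eqP; rewrite invrK; exact: (oppr_pchar2 charF (val x')).
  case=> /andP[zU /eqP ->].
    by exists z => //; rewrite inE; apply/orP; left; apply/imsetP; exists x.
  exists (- z) => //; rewrite inE; apply/orP; right.
  apply/imsetP; exists x^-1%g => //.
  congr ((_, _, _)) => /=; first by rewrite invgK.
    by rewrite -[LHS](oppr_pchar2 charF).
  by rewrite -[LHS]opprK.
have eqB : ((x, y, z) \in \bigcup_(v in V) block_B F v) =
    (z \in symmetrized V) && (y == 0).
  apply/bigcupP/andP => [[v vV]|].
    rewrite inE => /orP[] /imsetP[x' _ [_ -> ->]].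
      by rewrite mem_symmetrized.
    by split; [exact: mem_symmetrizedN | apply/eqP; exact: oppr0].
  case; rewrite inE => /orP[zV|/imsetP[v vV ->]] /eqP ->.
    by exists z => //; rewrite inE; apply/orP; left; apply/imsetP; exists x.
  exists v => //; rewrite inE; apply/orP; right.
  apply/imsetP; exists x^-1%g => //.
  by congr ((_, _, _)); rewrite /= ?invgK // -[LHS]oppr0.
have eqC : ((x, y, z) \in \bigcup_(w in W) block_C F w) =
    (z \in symmetrized W) && (x == 1%g).
  apply/bigcupP/andP => [[w wW]|].
    rewrite inE => /orP[] /imsetP[y' _ [-> _ ->]].
      by rewrite mem_symmetrized.
    by split; [exact: mem_symmetrizedN | apply/eqP; exact: invg1].
  case; rewrite inE => /orP[zW|/imsetP[w wW ->]] /eqP ->.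
    by exists z => //; rewrite inE; apply/orP; left; apply/imsetP; exists y.
  exists w => //; rewrite inE; apply/orP; right.
  apply/imsetP; exists (- y) => //.
  by congr ((_, _, _)); rewrite /= ?invg1 // -[LHS]opprK.
by rewrite eqA eqB eqC -!orbA !inE.
Qed.

Lemma unit_sqr_eq1 (x : {unit F}) : (val x) ^+ 2 = 1 -> x = 1%g.
Proof.
move=> x2; apply/val_inj/(sqr_inj_pchar2 charF) => /=.
by rewrite x2; symmetry; apply: expr1n.
Qed.

(** Restricting the parameter to x != 1 makes the families (x, x, u), (x, x^-1, -u), (x, 0, v) and
    (1, x + 1, w) disjoint and free of the identity: x, x^-1 and 0 are then distinct, and only the
    last family has unit component 1. *)
Lemma card_blocks_ge :
  ((#|F| - 2) * (2 * #|U| + #|symmetrized V| + #|symmetrized W|)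
   <= #|blocks F U V W :\ (1%g : Hgrp F n)|)%N.
Proof.
(* One label per family; each u in U occurs twice, for a_u and for its inverse. *)
pose D := [set s : ('Z_n + 'Z_n) + ('Z_n + 'Z_n) | match s with
  | inl (inl u) | inl (inr u) => u \in U
  | inr (inl v) => v \in symmetrized V
  | inr (inr w) => w \in symmetrized W end].
pose f (p : {unit F} * (('Z_n + 'Z_n) + ('Z_n + 'Z_n))) : Hgrp F n :=
  match p.2 with
  | inl (inl u) => (p.1, val p.1, u)
  | inl (inr u) => (p.1, (val p.1)^-1, - u)
  | inr (inl v) => (p.1, 0, v)
  | inr (inr w) => (1%g, val p.1 + 1, w) end.
have cD : #|D| = (2 * #|U| + #|symmetrized V| + #|symmetrized W|)%N.
  rewrite -sum1_card big_sumType /= !big_sumType /=.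
  rewrite mul2n -addnn -!addnA -!sum1_card; do 3?congr (_ + _)%N;
    by apply: eq_bigl => z; rewrite inE.
have c1 : #|[set~ 1%g : {unit F}]| = (#|F| - 2)%N.
  by rewrite cardsC1 -cardsT card_finField_unit subn2.
rewrite -cD -c1 -cardsX -(card_in_imset (f := f)).
  apply/subset_leq_card/fintype.subsetP => _ /imsetP[[x s] + ->].
  rewrite finset.in_setX finset.in_setC1 inE finset.in_setD1 => /andP[/= x1 sD].
  have xF1 : val x + 1 != 0.
    by rewrite addr_eq0 oppr_pchar2.
  rewrite mem_blocks; case: s sD => [] [] z /= zS; rewrite /f /= ?zS ?eqxx ?orbT ?andbT.
  - by rewrite !xpair_eqE (negPf x1).
  - by rewrite !xpair_eqE (negPf x1) opprK zS orbT.
  - by rewrite !xpair_eqE (negPf x1).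
  - by rewrite !xpair_eqE (negPf xF1) andbF.
have inv_neq (x : {unit F}) : x != 1%g -> val x <> (val x)^-1.
  move=> x1 E; case/eqP: x1; apply: unit_sqr_eq1.
  by rewrite expr2 {2}E divff ?unit_neq0.
have v0 (x : {unit F}) : val x <> 0 by apply/eqP/unit_neq0.
have vi0 (x : {unit F}) : (val x)^-1 <> 0 by apply/eqP; rewrite invr_eq0 unit_neq0.
move=> [x s] [y t]; rewrite !inE => /andP[/= x1 _] /andP[/= y1 _].
have x1' := elimN eqP x1; have y1' := elimN eqP y1.
case: s t => [] [] z [] [] z'; rewrite /f /= => -[].
all: try by [].
all: try by move=> ->.
all: try by move=> -> /v0.
all: try by move=> -> /vi0.
all: try by move=> /esym.
- by move=> -> _ ->.
- by move=> -> /(inv_neq _ y1).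
- by move=> -> /esym/(inv_neq _ y1).
- by move=> -> _ E; congr (_, inl (inr _)); apply/oppr_inj/val_inj.
- by move=> _ /esym/v0.
- by move=> _ /esym/vi0.
- by move=> -> ->.
- by move=> /addIr/val_inj -> ->.
Qed.

(** With z = x / (x + y) the quotient is z (1 - z), which is z^2 + z in characteristic 2. It is m /
    s^2 for the product (m, s, _) of a_u(x) and a_u'(y). *)
Lemma sum_prod_AS (x y : F) : x + y != 0 -> x * y / (x + y) ^+ 2 \in AS charF.
Proof.
move=> xy0; apply/ASP; exists (x / (x + y)).
have -> : x * y / (x + y) ^+ 2 = (- x ^+ 2 + (x + y) * x) / (x + y) ^+ 2.
  by congr (_ / _); ring.
by rewrite oppr_pchar2 //; field.
Qed.

(* As squaring preserves [AS] and its complement, writing [m = r ^ 2], [s = t^-1]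
   turns the conditions on [m / s ^ 2] and [m^-1 / s ^ 2] into the linear
   conditions on [t] that define [avoiding_pairs]. *)
Lemma avoiding_pair_not_product (z : 'Z_n) (p : {unit F} * F) (g h : Hgrp F n) :
  p \in avoiding_pairs charF -> z \notin pair_sums U V W ->
  g \in blocks F U V W -> h \in blocks F U V W ->
  (g * h)%g = ((p.1 * p.1)%g, p.2^-1, z) -> False.
Proof.
case: p => r t; rewrite inE /= => /and3P[r1 trL trL'] zS gX hX [eq1 eq2 eq3].
have r1F : val g.1.1 * val h.1.1 = val r ^+ 2 by rewrite expr2; exact: eq1.
have t0 : t != 0 by apply: contra trL => /eqP ->; rewrite mul0r group1.
have nsqr : ~ (t * val r) ^+ 2 \in AS charF by move/AS_sqr; apply/negP.
have nsqr' : ~ (t / val r) ^+ 2 \in AS charF by move/AS_sqr; apply/negP.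
have st0 : g.1.2 + h.1.2 != 0 by rewrite [_ + _]eq2 invr_eq0.
have tE : t = (g.1.2 + h.1.2)^-1 by rewrite [_ + _]eq2 invrK.
have zE : z = g.2 + h.2 by rewrite [_ + _]eq3.
have UU x y : x \in U -> y \in U -> z = x - y -> False.
  move=> xU yU zxy; case/negP: zS; rewrite zxy.
  by rewrite !finset.in_setU (imset2_f (fun x y : 'Z_n => x - y) xU yU).
have UVW x y : x \in symmetrized U -> y \in symmetrized V :|: symmetrized W ->
    z = x + y -> False.
  move=> xU yV zxy; case/negP: zS; rewrite zxy.
  by rewrite !finset.in_setU (imset2_f (fun x y : 'Z_n => x + y) xU yV) ?orbT.
have VW x y : x \in symmetrized V -> y \in symmetrized W -> z = x + y -> False.
  move=> xV yW zxy; case/negP: zS; rewrite zxy.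
  by rewrite !finset.in_setU (imset2_f (fun x y : 'Z_n => x + y) xV yW) ?orbT.
have inU x : - x \in U -> x \in symmetrized U by move/mem_symmetrizedN; rewrite opprK.
have zE' : z = h.2 + g.2 by rewrite addrC.
move: gX hX; rewrite !mem_blocks.
(* Each factor is of kind a, a^-1, b or c. Two factors of the same kind contradict, in this order,
   [nsqr], [nsqr'], s != 0 and r != 1; every mixed case puts z into [pair_sums]. *)
case/or4P=> /andP[gS /eqP gE]; case/or4P=> /andP[hS /eqP hE].
- apply: nsqr; rewrite exprMn -r1F tE exprVn mulrC gE hE.
  by apply: sum_prod_AS; rewrite -gE -hE.
- by apply: (UU _ _ gS hS); rewrite opprK.
- by apply: (UVW _ _ (mem_symmetrized gS) _ zE); rewrite finset.in_setU hS.
- by apply: (UVW _ _ (mem_symmetrized gS) _ zE); rewrite finset.in_setU hS orbT.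
- by apply: (UU _ _ hS gS); rewrite opprK.
(* The field components are the inverses of the unit components, so their product is m^-1. *)
- apply: nsqr'; rewrite exprMn exprVn -r1F tE exprVn mulrC invfM gE hE.
  by apply: sum_prod_AS; rewrite -gE -hE.
- by apply: (UVW _ _ (inU _ gS) _ zE); rewrite finset.in_setU hS.
- by apply: (UVW _ _ (inU _ gS) _ zE); rewrite finset.in_setU hS orbT.
- by apply: (UVW _ _ (mem_symmetrized hS) _ zE'); rewrite finset.in_setU gS.
- by apply: (UVW _ _ (inU _ hS) _ zE'); rewrite finset.in_setU gS.
- by move: st0; rewrite gE hE addr0 eqxx.
- exact: VW gS hS zE.
- by apply: (UVW _ _ (mem_symmetrized hS) _ zE'); rewrite finset.in_setU gS orbT.
- by apply: (UVW _ _ (inU _ hS) _ zE'); rewrite finset.in_setU gS orbT.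
- exact: VW hS gS zE'.
- case/eqP: r1; apply: unit_sqr_eq1.
  by rewrite -r1F gE hE; exact: mulr1.
Qed.

(** Distinct pairs encode distinct elements over z, since squaring and inversion are injective. By
    diameter 2 each of these lies in X or is a product with a factor in E: at most |X| + 2e|X|
    elements. *)
Lemma card_avoiding_pairs_le (e : nat) (E X : {set Hgrp F n}) (z : 'Z_n) :
  X = (blocks F U V W :\ 1%g) :|: E -> #|E| = e -> diameter (cayley X) 2 ->
  z \notin pair_sums U V W ->
  (#|avoiding_pairs charF| <= (2 * e + 1) * #|X|)%N.
Proof.
move=> XE Ee diam zS.
pose f (p : {unit F} * F) : Hgrp F n := ((p.1 * p.1)%g, p.2^-1, z).
have f_inj : injective f.
  move=> [r t] [s u] [] rs /invr_inj ->.
  by congr (_, _); apply/val_inj/(sqr_inj_pchar2 charF); rewrite !expr2.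
rewrite -(card_imset _ f_inj).
have sub : f @: avoiding_pairs charF \subset
    X :|: [set (g * h)%g | g in E, h in X] :|: [set (g * h)%g | g in X, h in E].
  apply/fintype.subsetP => _ /imsetP[p pA ->]; rewrite !finset.in_setU.
  case: (cayley_diameter2 (f p) diam) => [f1|->//|[g [h [gX hX fE]]]].
    move: pA; rewrite inE => /and3P[/eqP []]; apply: unit_sqr_eq1.
    by move/(congr1 (fun g : Hgrp F n => val g.1.1)): f1; rewrite expr2.
  rewrite fE.
  have [gE|gE] := boolP (g \in E); first by rewrite (imset2_f mulg gE hX) orbT.
  have [hE|hE] := boolP (h \in E); first by rewrite (imset2_f mulg gX hE) orbT.
  move: gX hX; rewrite XE !finset.in_setU (negPf gE) (negPf hE) !orbF.
  rewrite !finset.in_setD1 => /andP[_ gB] /andP[_ hB].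
  by case: (avoiding_pair_not_product pA zS gB hB (esym fE)).
apply: leq_trans (subset_leq_card sub) _.
have c1 := card_imset2_leq mulg E X; have c2 := card_imset2_leq mulg X E.
rewrite Ee in c1 c2.
rewrite cardsU; apply: leq_trans (leq_subr _ _) _.
rewrite cardsU; apply: leq_trans (leq_add (leq_subr _ _) c2) _.
apply: leq_trans (leq_add (leq_add (leqnn _) c1) (leqnn _)) _.
by move: #|X| => m; clear; nia.
Qed.
End Covering.

(** * The bound on n *)

Lemma realizable_bound (l n : nat) (delta : int) (e : nat) :
  (1 < n)%N -> realizable l n delta e -> (8 * n <= 3 * l ^ 2)%N.
Proof.
move=> n1 real_ln.
(* For q > K both q - 2 > 4 (2e + 1) (l + |delta|), used for [full], and q > 2 (l + 1) + |delta|,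
   used for [sl]. The field of 2^(K+1) elements is large enough. *)
pose K := (6 + 4 * (2 * e + 1) * (l + `|delta|))%N.
have [F charF cF] := pPrimePowerField (isT : prime 2) (isT : (0 < K.+1)%N).
have qK : (K < #|F|)%N by rewrite cF; apply: ltn_trans (ltn_expl _ _).
have [X [U [V [W [E [_ [Ee _ _] XE _ [cX diam]]]]]]] := real_ln F.
have cB := card_blocks_ge charF U V W.
have BX : (#|blocks F U V W :\ 1%g| <= #|X|)%N.
  by rewrite subset_leq_card // XE finset.subsetUl.
have Xq : (#|X| <= (l + `|delta|) * #|F|)%N.
  by move: cX qK; move: #|X| #|F| => x q; rewrite /K; nia.
(* A missing z would leave at least (q - 2) q / 4 avoiding pairs, against an upper bound linear in
   q. *)
have full : pair_sums U V W = [set: 'Z_n].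
  apply/setP => z; rewrite finset.in_setT; apply/negPn/negP => zS.
  have le1 := card_avoiding_pairs charF.
  have le2 := card_avoiding_pairs_le charF XE Ee diam zS.
  have le3 : ((#|F| - 2) * #|F| <= 4 * (2 * e + 1) * (l + `|delta|) * #|F|)%N.
    apply: leq_trans le1 _; rewrite -!mulnA leq_mul2l /=.
    by apply: leq_trans le2 _; rewrite leq_mul2l Xq orbT.
  rewrite leq_mul2r in le3; move: le3 qK; rewrite /K.
  by case: #|F| => [|q] /=; lia.
have := card_pair_sums U V W; rewrite full cardsT card_ord Zp_cast //.
move: cB; set s := (_ + _ + _)%N => cB s_n; apply: leq_trans s_n _.
(* Otherwise (q - 2) (l + 1) <= |X| = l q + delta, which bounds q. *)
have sl : (s <= l)%N.
  rewrite leqNgt; apply/negP => ls.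
  have : ((#|F| - 2) * l.+1 <= #|X|)%N.
    by apply: leq_trans BX; apply: leq_trans cB; rewrite leq_mul2l ls orbT.
  by move: cX qK; move: #|X| #|F| => x q; rewrite /K; nia.
by rewrite leq_mul2l leq_exp2r.
Qed.

(** * From the bound on n to the order of the graph *)

Lemma card_Hgrp (F : finFieldType) (n : nat) :
  (1 < n)%N -> #|Hgrp F n| = (#|F|.-1 * #|F| * n)%N.
Proof.
move=> n1; rewrite !card_prod card_ord Zp_cast //.
by rewrite -card_finField_unit cardsT.
Qed.

Unset Implicit Arguments.
Set Strict Implicit.
Local Open Scope classical_set_scope.

Theorem theorem3 (R : realType) (delta : int) :
  exists g : nat -> R,
    g =O_\oo (fun d : nat => d%:R : R) /\
    forall d : nat,
      (ACsup R delta d <= (3%:R / 8%:R * d%:R ^+ 2 + g d)%:E)%E.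
Proof.
pose m : R := `|delta|%:~R.
have m0 : 0 <= m by rewrite ler0z.
(* These are the lower terms of 3/8 (d + |delta|)^2. *)
exists (fun d => 3%:R / 4%:R * m * d%:R + 3%:R / 8%:R * m ^+ 2); split.
  apply/eqOP; near=> k; near=> d.
  have d1 : 1 <= d%:R :> R by rewrite ler1n; near: d; exact: nbhs_infty_ge.
  have km : 3%:R / 4%:R * m + 3%:R / 8%:R * m ^+ 2 <= k by near: k; apply: nbhs_pinfty_ge; exact: num_real.
  rewrite !ger0_norm; [|lra|nra].
  nra.
(* The bound is independent of l, so it passes through both suprema. *)
move=> d; apply: ge_ereal_sup => _ [l /= l3 <-].
apply: ge_ereal_sup => _ [n [e [F [X [n_l real_ln conn Xd ->]]]]].
have n1 : (1 < n)%N by case: n_l => -[].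
have nl := realizable_bound n1 real_ln.
have cX : d%:Z = l%:Z * #|F|%:Z + delta.
  by case: conn => [U [V [W [E [_ _ _ _ [<- _]]]]]]; rewrite Xd.
(* Stated over the integers, as delta may have either sign; d - delta is l q. *)
have le8 : 8 * #|Hgrp F n|%:Z <= 3 * (d%:Z - delta) ^+ 2.
  rewrite cX addrK card_Hgrp //; move: nl; move: #|F| => q nl.
  have : (8 * (q.-1 * q * n) <= 3 * (l * q) ^ 2)%N.
    have : (q.-1 * q * (8 * n) <= q * q * (3 * l ^ 2))%N.
      by apply: leq_mul => //; apply: leq_mul => //; apply: leq_pred.
    by rewrite expnMn; nia.
  nia.
have {}le8 : 8 * (#|Hgrp F n|%:R : R) <= 3 * (d%:R - delta%:~R) ^+ 2.
  by move: le8; rewrite -(ler_int R) !(rmorphM, rmorphXn, rmorphB) /= -!pmulrn.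
have dm : `|delta%:~R| <= m by rewrite /m intr_norm.
have [dm1 dm2] : - m <= delta%:~R /\ delta%:~R <= m :> R.
  by move: dm; rewrite ler_norml => /andP.
have d0 : 0 <= d%:R :> R by [].
rewrite lee_fin; nra.
Unshelve. all: by end_near.
Qed.
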